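(* Let $j\in J$ and let $T:\mathcal{H}\to\mathcal{H}$ be an $(\alpha_j,j)$-contraction. Then: (i) The $j$-th componental fixed point set $\operatorname{Fix}^{j}T:=\{x\in\mathcal{H}\mid (T(x))_j=x_j\}$ is nonempty, and the component $x_j$ is the same for all $x\in\operatorname{Fix}^{j}T$; denote this unique value by $x_{j\ast}\in\mathcal{H}_j$. (ii) For any initial point $x^0\in\mathcal{H}$, the sequence $\{x^k_j\}_{k=0}^\infty$ of $j$-th components of the sequence $\{x^k\}_{k=0}^\infty$ generated by the Picard iteration $x^{k+1}=T(x^k)$ converges, and $\lim_{k\to\infty}x_j^k=x_{j\ast}$. (iii) The following a priori and a posteriori error estimates hold: $$\|x_j^k-x_{j\ast}\|_j\le\frac{(\alpha_j)^k}{1-\alpha_j}\|x_j^0-x_j^1\|_j\quad\text{for all }k=1,2,\ldots,$$ $$\|x_j^k-x_{j\ast}\|_j\le\frac{\alpha_j}{1-\alpha_j}\|x_j^{k-1}-x_j^k\|_j\quad\text{for all }k=1,2,\ldots.$$ (iv) The rate of convergence of the sequence $\{x_j^k\}_{k=0}^\infty$ in (ii) is given by $$\|x_j^k-x_{j\ast}\|_j\le\alpha_j\|x_j^{k-1}-x_{j\ast}\|_j\le(\alpha_j)^k\|x_j^0-x_{j\ast}\|_j\quad\text{for all }k=1,2,\ldots.$$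
   Context: Let $n\ge 2$, $J:=\{1,\dots,n\}$, and let $\mathcal{H}_j$, $j\in J$, be real Hilbert spaces with inner products $\langle\cdot,\cdot\rangle_j$ and induced norms $\|\cdot\|_j$. $\mathcal{H}:=\mathcal{H}_1\times\cdots\times\mathcal{H}_n$ is the product Hilbert space with $\langle x,y\rangle=\sum_{j=1}^n\langle x_j,y_j\rangle_j$. For $T:\mathcal{H}\to\mathcal{H}$ write $T(x)=((T(x))_1,\dots,(T(x))_n)$ with $(T(x))_j\in\mathcal{H}_j$. For $j\in J$ and $\alpha_j\in[0,1)$, $T$ is an $(\alpha_j,j)$-contraction if $\|(T(x))_j-(T(y))_j\|_j\le\alpha_j\|x_j-y_j\|_j$ for all $x,y\in\mathcal{H}$. *)

(* Defs.v *)
From HB Require Import structures.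
From mathcomp Require Import all_boot all_order all_algebra sesquilinear.
From mathcomp Require Import all_classical all_reals all_analysis.
From mathcomp Require Import ring.

Set Implicit Arguments.
Unset Strict Implicit.
Unset Printing Implicit Defensive.

Import Order.TTheory GRing.Theory Num.Theory.
Import numFieldNormedType.Exports.

Local Open Scope classical_set_scope.
Local Open Scope ring_scope.

(* For theta := idfun, {dot V for theta} is the type of symmetric positive
   definite bilinear forms.  Topology and completeness are those of the
   underlying complete normed module, whose norm is the one induced by
   inner. *)
HB.mixin Record CompleteNormedModule_isHilbert (R : realType) V
    & CompleteNormedModule R V := {
  inner : {dot V for (@idfun R)} ;
  norm_innerE : forall x : V, `|x| = Num.sqrt (inner x x)
}.

#[short(type="hilbertType")]
HB.structure Definition Hilbert (R : realType) :=
  {V of CompleteNormedModule R V & CompleteNormedModule_isHilbert R V}.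

Section dot_norm.
Variables (R : realType) (V : lmodType R) (f : {dot V for (@idfun R)}).

Let N x := Num.sqrt (f x x).

Lemma dotC x y : f x y = f y x.
Proof. by rewrite (@hermitian_subproof _ _ _ _ f) expr0 mul1r. Qed.

Lemma dot_ge0 x : 0 <= f x x.
Proof.
have [->|x0] := eqVneq x 0; first by rewrite linear0r.
exact/ltW/neq0_dnorm_gt0.
Qed.

Lemma dot_norm0_eq0 x : N x = 0 -> x = 0.
Proof.
move=> /eqP; rewrite sqrtr_eq0; apply: contraTeq => x0.
by rewrite -ltNge neq0_dnorm_gt0.
Qed.

Lemma dot_normZ a x : N (a *: x) = `|a| * N x.
Proof.
by rewrite /N linearZl linearZr /= mulrA -expr2 sqrtrM ?sqr_ge0// sqrtr_sqr.
Qed.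

Lemma dot_CauchySchwarz x y : f x y <= N x * N y.
Proof.
have [->|x0] := eqVneq x 0; first by rewrite linear0l mulr_ge0 ?sqrtr_ge0.
have Nx : 0 < f x x by exact: neq0_dnorm_gt0.
rewrite -sqrtrM ?dot_ge0// (le_trans (ler_norm _))// -sqrtr_sqr ler_wsqrtr//.
have := dot_ge0 (f x x *: y - f x y *: x).
rewrite linearBl !linearBr !linearZl !linearZr/= !(dotC y x).
rewrite [X in 0 <= X](_ : _ = f x x * (f x x * f y y - f x y ^+ 2)); last by ring.
by rewrite pmulr_rge0// subr_ge0.
Qed.

Lemma dot_normD x y : N (x + y) <= N x + N y.
Proof.
rewrite -ler_sqr ?nnegrE ?addr_ge0 ?sqrtr_ge0// sqrrD !sqr_sqrtr ?dot_ge0//.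
rewrite linearDl !linearDr/= (dotC y x) addrA lerD2r -addrA lerD2l -mulr2n.
by rewrite lerMn2r dot_CauchySchwarz.
Qed.

End dot_norm.

(* H_1 x ... x H_n, given below its Hilbert space structure for the inner
   product \sum_i <x_i, y_i>; the component x_i is the application x i. *)
Definition hprod (R : realType) (n : nat) (H : 'I_n -> hilbertType R) : Type :=
  forall i, H i.

Section hprod_lmod.
Variables (R : realType) (n : nat) (H : 'I_n -> hilbertType R).
Implicit Types x y z : hprod H.

HB.instance Definition _ := gen_eqMixin (hprod H).
HB.instance Definition _ := gen_choiceMixin (hprod H).

Let zero : hprod H := fun=> 0.
Let opp x : hprod H := fun i => - x i.
Let add x y : hprod H := fun i => x i + y i.
Let scale (a : R) x : hprod H := fun i => a *: x i.

Let addA : associative add.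
Proof. by move=> x y z; apply: functional_extensionality_dep => i; exact: addrA. Qed.
Let addC : commutative add.
Proof. by move=> x y; apply: functional_extensionality_dep => i; exact: addrC. Qed.
Let add0 : left_id zero add.
Proof. by move=> x; apply: functional_extensionality_dep => i; exact: add0r. Qed.
Let addN : left_inverse zero opp add.
Proof. by move=> x; apply: functional_extensionality_dep => i; exact: addNr. Qed.

HB.instance Definition _ := GRing.isZmodule.Build (hprod H) addA addC add0 addN.

Let scaleA a b x : scale a (scale b x) = scale (a * b) x.
Proof. by apply: functional_extensionality_dep => i; exact: scalerA. Qed.
Let scale1 : left_id 1 scale.
Proof. by move=> x; apply: functional_extensionality_dep => i; exact: scale1r. Qed.
Let scaleDr : right_distributive scale +%R.
Proof. by move=> a x y; apply: functional_extensionality_dep => i; exact: scalerDr. Qed.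
Let scaleDl x : {morph scale^~ x : a b / a + b}.
Proof. by move=> a b; apply: functional_extensionality_dep => i; exact: scalerDl. Qed.

HB.instance Definition _ :=
  GRing.Zmodule_isLmodule.Build R (hprod H) scaleA scale1 scaleDr scaleDl.

Lemma hprodD x y i : (x + y) i = x i + y i. Proof. by []. Qed.
Lemma hprodN x i : (- x) i = - x i. Proof. by []. Qed.
Lemma hprodZ (a : R) x i : (a *: x) i = a *: x i. Proof. by []. Qed.

Definition hprod_inner x y : R := \sum_i inner (x i) (y i).

Let inner_bilinear : bilinear_for *%R (idfun \; *%R) hprod_inner.
Proof.
split=> u a x y; rewrite /hprod_inner /= mulr_sumr -big_split/=;
  apply: eq_bigr => i _; rewrite hprodD hprodZ.
- by rewrite linearPl.
- by rewrite linearPr.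
Qed.

HB.instance Definition _ := bilinear_isBilinear.Build R (hprod H) (hprod H) R
  *%R (idfun \; *%R) hprod_inner inner_bilinear.

Let inner_sym x y : hprod_inner x y = (-1) ^+ false * idfun (hprod_inner y x).
Proof. by rewrite expr0 mul1r; apply: eq_bigr => i _; exact: dotC. Qed.

HB.instance Definition _ := isHermitianSesquilinear.Build R (hprod H)
  false idfun hprod_inner inner_sym.

Let inner_gt0 x : x != 0 -> 0 < hprod_inner x x.
Proof.
move=> x0; rewrite lt_neqAle sumr_ge0 ?andbT => [|i _]; last exact: dot_ge0.
apply: contra_neq x0 => /esym s0; apply: functional_extensionality_dep => i.
apply: (@dot_norm0_eq0 _ _ inner); apply/eqP; rewrite sqrtr_eq0.
by rewrite (psumr_eq0P _ s0)// => k _; exact: dot_ge0.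
Qed.

HB.instance Definition _ := isDotProduct.Build R (hprod H) hprod_inner inner_gt0.

HB.instance Definition _ := Lmodule_isNormed.Build R (hprod H)
  (@dot_normD _ _ hprod_inner) (@dot_normZ _ _ hprod_inner)
  (@dot_norm0_eq0 _ _ hprod_inner).

Lemma hprod_normE x : `|x| = Num.sqrt (hprod_inner x x).
Proof. by []. Qed.

Lemma le_norm_hprod x i : `|x i| <= `|x|.
Proof.
rewrite hprod_normE norm_innerE ler_wsqrtr// /hprod_inner (bigD1 i)//= lerDl.
by rewrite sumr_ge0// => k _; exact: dot_ge0.
Qed.

Lemma norm_hprod_le x : `|x| <= \sum_i `|x i|.
Proof.
rewrite -ler_sqr ?nnegrE ?sumr_ge0// hprod_normE sqr_sqrtr ?dot_ge0//.
rewrite /hprod_inner expr2 mulr_suml ler_sum// => i _.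
rewrite -[leLHS]sqr_sqrtr ?dot_ge0// -norm_innerE expr2 ler_wpM2l//.
by rewrite (bigD1 i)//= lerDl sumr_ge0.
Qed.

Let hprod_complete (F : set_system (hprod H)) :
  ProperFilter F -> cauchy F -> cvg F.
Proof.
move=> FF Fc.
have cF i : cvg ((fun x : hprod H => x i) @ F).
  apply: cauchy_cvg; apply/cauchyP => e e0.
  have /cauchyP/(_ e e0)[x Fx] := Fc.
  exists (x i); rewrite /nbhs/=; apply: filterS Fx => y.
  rewrite -!ball_normE/=; apply: le_lt_trans.
  by rewrite -hprodN -hprodD le_norm_hprod.
pose l : hprod H := fun i => lim ((fun x : hprod H => x i) @ F).
apply/cvg_ex; exists l; apply/cvgrPdist_lt => e e0.
have d0 : 0 < e / n.+1%:R by rewrite divr_gt0.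
near=> x; rewrite (le_lt_trans (norm_hprod_le _))//.
apply: (@le_lt_trans _ _ (\sum_(i < n) e / n.+1%:R)); last first.
  rewrite sumr_const card_ord -[ltLHS]mulr_natr -mulrA gtr_pMr// mulrC.
  by rewrite ltr_pdivrMr// mul1r ltr_nat.
apply: ler_sum => i _; rewrite hprodD hprodN ltW//.
move: i; near: x; apply: filter_forall => i.
have /cvgrPdist_lt/(_ _ d0) := cF i; exact.
Unshelve. all: by end_near. Qed.

HB.instance Definition _ := Uniform_isComplete.Build (hprod H) hprod_complete.

HB.instance Definition _ :=
  CompleteNormedModule_isHilbert.Build R (hprod H) hprod_normE.

End hprod_lmod.

Section contraction.
Variables (R : realType) (n : nat) (H : 'I_n -> hilbertType R) (j : 'I_n).

Definition component_contraction (alpha : R) (T : hprod H -> hprod H) : Prop :=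
  forall x y, `|T x j - T y j| <= alpha * `|x j - y j|.

Definition component_Fix (T : hprod H -> hprod H) : set (hprod H) :=
  [set x | T x j = x j].

End contraction.

(* Main.v *)
(* The contraction condition forces the j-th component of T x to depend on x j
   only, so freezing the other components at 0 gives an honest contraction of
   H j, whose Banach fixed point, padded with zeros, is in component_Fix j T.
   Uniqueness, convergence and the estimates use T only through its effect on
   the distance between j-th components; both error estimates are instances of
   |x j - p j| <= |x j - T x j| / (1 - alpha). *)
From HB Require Import structures.
Require Import Defs.
From mathcomp Require Import all_boot all_order all_algebra sesquilinear.
From mathcomp Require Import all_classical all_reals all_analysis.
From mathcomp Require Import lra.

Set Implicit Arguments.
Unset Strict Implicit.
Unset Printing Implicit Defensive.

Import Order.TTheory GRing.Theory Num.Theory.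
Import numFieldNormedType.Exports.

Local Open Scope classical_set_scope.
Local Open Scope ring_scope.

(** [banach_fixed_point] expects a function bundled between sets, so [S] is packed as a self-map of
    the full set, which is closed and contains 0. *)
Lemma contraction_has_fixpoint (R : realType) (V : completeNormedModType R)
    (alpha : R) (S : V -> V) :
  0 <= alpha < 1 -> (forall u v, `|S u - S v| <= alpha * `|u - v|) ->
  exists u, S u = u.
Proof.
move=> /andP[a0 a1] hS.
have Sfun : set_fun [set: V] [set: V] S by [].
pose f : {fun [set: V] >-> [set: V]} :=
  HB.pack S (isFun.Build _ _ _ _ S Sfun).
have [| |u _ uE] := @banach_fixed_point R V [set: V] f _ closedT.
- exists (NngNum a0); split => //= -[u v] _; exact: hS.
- by exists 0.
- by exists u; rewrite [RHS]uE.
Qed.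

Section component_contraction.
Variables (R : realType) (n : nat) (H : 'I_n -> hilbertType R) (j : 'I_n).
Variables (alpha : R) (T : hprod H -> hprod H).
Hypothesis halpha : 0 <= alpha < 1.
Hypothesis hT : component_contraction j alpha T.

Lemma component_Fix_nonempty : component_Fix j T !=set0.
Proof.
pose e (u : H j) : hprod H := @dfwith _ H (0 : hprod H) j u.
have eE u : e u j = u by rewrite /e dfwithin.
have [|u uE] := @contraction_has_fixpoint R (H j) alpha (fun u => T (e u) j) halpha.
  (* Only [u] and [v] on the right-hand side become [e u j] and [e v j], to match [hT]. *)
  by move=> u v; rewrite -{2}(eE u) -{2}(eE v); exact: hT.
by exists (e u); rewrite /component_Fix /= uE eE.
Qed.

(** The other components of [p] may move under [T]; trading [p j] for [T p j] on the left is all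
    that is needed. *)
Lemma component_Fix_contract p x : component_Fix j T p ->
  `|T x j - p j| <= alpha * `|x j - p j|.
Proof. by rewrite /component_Fix /= => {1}<-; exact: hT. Qed.

Lemma component_Fix_unique p q :
  component_Fix j T p -> component_Fix j T q -> p j = q j.
Proof.
move=> hp hq; have /andP[_ a1] := halpha.
have := component_Fix_contract q hp; rewrite (hq : T q j = q j) (distrC (q j)) => d1.
have d0 := normr_ge0 (p j - q j).
(* A distance [d >= 0] with [d <= alpha * d] and [alpha < 1] vanishes. *)
by apply/eqP; rewrite -subr_eq0 -normr_eq0; apply/eqP; nra.
Qed.

Lemma component_iter_contract p x k : component_Fix j T p ->
  `|iter k T x j - p j| <= alpha ^+ k * `|x j - p j|.
Proof.
move=> hp; elim: k => [|k IH]; first by rewrite expr0 mul1r.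
have /andP[a0 _] := halpha.
rewrite iterS (le_trans (component_Fix_contract _ hp))//.
by rewrite exprS -mulrA ler_wpM2l.
Qed.

(** The triangle inequality through [T x j] leaves a term at most [alpha * |x j - p j|], absorbed on
    the left. *)
Lemma component_dist_Fix p x : component_Fix j T p ->
  `|x j - p j| <= `|x j - T x j| / (1 - alpha).
Proof.
move=> hp; have /andP[_ a1] := halpha.
rewrite ler_pdivlMr ?subr_gt0//.
have := ler_distD (T x j) (x j) (p j).
have := component_Fix_contract x hp; lra.
Qed.

Lemma component_iter_cvg p x : component_Fix j T p ->
  (fun k => iter k T x j) @ \oo --> p j.
Proof.
move=> hp; have /andP[a0 a1] := halpha.
apply/subr_cvg0/norm_cvg0P.
apply: (@squeeze_cvgr _ _ _ _ (cst 0) (fun k => alpha ^+ k * `|x j - p j|)).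
- by near=> k; rewrite normr_ge0 component_iter_contract.
- exact: cvg_cst.
- rewrite -(mul0r `|x j - p j|); apply: cvgMr_tmp.
  by apply: cvg_expr; rewrite ger0_norm.
Unshelve. all: by end_near. Qed.

End component_contraction.

Theorem theorem22 (R : realType) (n : nat) (hn : (2 <= n)%N)
  (H : 'I_n -> hilbertType R) (j : 'I_n) (alpha : R)
  (halpha : 0 <= alpha < 1) (T : hprod H -> hprod H)
  (hT : component_contraction j alpha T) :
  exists xs : H j,
    [/\ component_Fix j T !=set0,
        (forall x : hprod H, component_Fix j T x -> x j = xs) &
        forall x0 : hprod H, let x := fun k : nat => iter k T x0 in
          [/\ (fun k : nat => x k j) @ \oo --> xs,
              (forall k : nat, (1 <= k)%N ->
                 `|x k j - xs| <= alpha ^+ k / (1 - alpha) * `|x 0%N j - x 1%N j|),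
              (forall k : nat, (1 <= k)%N ->
                 `|x k j - xs| <= alpha / (1 - alpha) * `|x k.-1 j - x k j|) &
              (forall k : nat, (1 <= k)%N ->
                 `|x k j - xs| <= alpha * `|x k.-1 j - xs|
                               <= alpha ^+ k * `|x 0%N j - xs|)]].
Proof.
have [p hp] := component_Fix_nonempty halpha hT.
have /andP[a0 _] := halpha.
exists (p j); split; [by exists p | | move=> x0 x; split].
- by move=> q hq; exact: (component_Fix_unique halpha hT).
- exact: (component_iter_cvg halpha hT).
(* A priori: contract [k] times back to [x0], then bound the distance from [x0]. *)
- move=> k _; apply: le_trans (component_iter_contract halpha hT x0 k hp) _.
  rewrite -mulrA ler_wpM2l ?exprn_ge0// mulrC.
  exact: (component_dist_Fix halpha hT).
(* A posteriori: contract once, then apply the distance bound at the previous iterate, whose image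
   under [T] is the current one. *)
- move=> [//|k] _; rewrite /x iterS.
  apply: le_trans (component_Fix_contract hT _ hp) _.
  rewrite -mulrA ler_wpM2l// mulrC; exact: (component_dist_Fix halpha hT).
- move=> [//|k] _; rewrite /x iterS (component_Fix_contract hT _ hp)/=.
  by rewrite exprS -mulrA ler_wpM2l// (component_iter_contract halpha hT).
Qed.
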